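(* For every integer $n\ge 0$, $c_5(n)$ is odd if $n=(7j^2+j)/2$ for some $j\in\mathbb{Z}$, and $c_5(n)$ is even otherwise.
   Context: A partition of $n\ge 0$ is a finite multiset of positive integers summing to $n$; the empty partition is the partition of $0$. For $n\ge 0$, $c_5(n)$ denotes the number of partitions $\lambda$ of $n$ such that either (a) all parts of $\lambda$ are even and distinct, or (b) there is an integer $j\ge 1$ such that the set of odd parts of $\lambda$ is exactly $\{1,3,\dots,2j-1\}$, each of these appearing exactly two or three times, and the even parts of $\lambda$ are distinct and each at least $4j+2$ (i.e. at least twice the largest odd part plus $4$). *)

(* Defs.v *)
From mathcomp Require Import all_boot all_order all_algebra.
Set Implicit Arguments. Unset Strict Implicit. Unset Printing Implicit Defensive.

(* A partition of n is encoded by its multiplicity function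
   m : {ffun 'I_n -> 'I_n.+1}, where m i is the number of parts equal to i+1,
   subject to \sum_i (i+1) * m i = n.  This is a bijection with partitions
   of n (every part lies in 1..n and has multiplicity <= n). *)

Definition is_partition (n : nat) (m : {ffun 'I_n -> 'I_n.+1}) : bool :=
  \sum_(i < n) i.+1 * m i == n.

(* multiplicity of the part k (0 for k = 0 or k > n) *)
Definition mult (n : nat) (m : {ffun 'I_n -> 'I_n.+1}) (k : nat) : nat :=
  \sum_(i < n | i.+1 == k) (m i : nat).

Definition c5_condA (n : nat) (m : {ffun 'I_n -> 'I_n.+1}) : bool :=
  [forall k : 'I_n.+1, (mult m k <= 1) && (odd k ==> (mult m k == 0))].

(* (b) for some j >= 1: odd parts are exactly 1,3,...,2j-1, each appearing
   2 or 3 times; even parts distinct and each >= 4j+2.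
   (j <= n and k <= 2n suffice: any valid j has 2 j^2 <= n, and parts are <= n.) *)
Definition c5_condB (n : nat) (m : {ffun 'I_n -> 'I_n.+1}) : bool :=
  [exists j : 'I_n.+1, (0 < j) &&
    [forall k : 'I_(2 * n).+1,
      if odd k then
        (if k <= 2 * j - 1 then (mult m k == 2) || (mult m k == 3)
         else mult m k == 0)
      else (mult m k <= 1) && ((0 < mult m k) ==> (4 * j + 2 <= k))]].

Definition c5 (n : nat) : nat :=
  #|[set m : {ffun 'I_n -> 'I_n.+1} | is_partition m && (c5_condA m || c5_condB m)]|.

(* Main.v *)
Require Import Defs.
From mathcomp Require Import all_boot all_order all_algebra.
From mathcomp Require Import qpoly zify ring.
Import GRing.Theory.

(** Writing [Q = q^2], the generating function of [c5] is
    [\sum_j Q^(j^2) (-q; q^2)_j (-Q^(2j+1); Q)_oo].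
    Modulo 2, [(-q; q^2)_j] is the sum over [r] in [Z] of
    [q^(r(3r+1)/2) (2j choose j-r)_Q], and summing over [j] first leaves
    [\sum_j Q^(j^2) (2j choose j-r)_Q (Q^(2j+1); Q)_oo = Q^(r^2)], a
    Durfee-rectangle identity.  The series is therefore [\sum_r q^((7r^2+r)/2)]
    modulo 2 (the first Rogers-Selberg identity), and [r |-> (7r^2+r)/2] is
    injective on [Z].  All series identities are proved in a commutative ring
    where [q] is nilpotent, then applied to [F_2[X] / X^(n+1)]. *)

(** * Gaussian binomials: ratios, symmetry, weighted sums *)

Section GaussianBinomials.

Local Open Scope ring_scope.

Variables (R : comNzRingType) (Q : R).

(* [gauss R Q a b] is the Gaussian binomial (a + b choose a) in base Q. *)
Fixpoint gauss (a b : nat) {struct a} : R :=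
  if a is a'.+1 then
    (fix gauss_a (b : nat) : R :=
       if b is b'.+1 then gauss a' b'.+1 + Q ^+ a'.+1 * gauss_a b'
       else 1) b
  else 1.

Arguments gauss : simpl never.

Lemma gauss0n b : gauss 0 b = 1.
Proof. by []. Qed.

Lemma gaussn0 a : gauss a 0 = 1.
Proof. by case: a. Qed.

Lemma gaussSS a b :
  gauss a.+1 b.+1 = gauss a b.+1 + Q ^+ a.+1 * gauss a.+1 b.
Proof. by []. Qed.

(** Joint induction, using [1 - Q^(a+b+2) = (1 - Q^(a+1)) + Q^(a+1) (1 - Q^(b+1))]. The two ratios
    stand in for the q-factorial formula, whose denominators may be zero divisors in [R]. *)
Lemma gauss_ratios a b :
  (1 - Q ^+ b.+1) * gauss a b.+1 = (1 - Q ^+ (a + b).+1) * gauss a b /\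
  (1 - Q ^+ a.+1) * gauss a.+1 b = (1 - Q ^+ (a + b).+1) * gauss a b.
Proof.
have [s] := ubnP (a + b); elim: s => // s IHs in a b *; rewrite ltnS => le_ab_s.
split.
- case: a => [|a] in le_ab_s *; first by rewrite !gauss0n.
  have [r1 r2] := IHs a b le_ab_s.
  rewrite gaussSS mulrDr r1 -r2 addSn.
  have -> : Q ^+ (a + b).+2 = Q ^+ a.+1 * Q ^+ b.+1 by rewrite -exprD addSn addnS.
  by ring.
- case: b => [|b] in le_ab_s *; first by rewrite !gaussn0 addn0.
  rewrite addnS in le_ab_s.
  have [r1 r2] := IHs a b le_ab_s.
  rewrite gaussSS mulrDr mulrCA r2 -r1 addnS.
  have -> : Q ^+ (a + b).+2 = Q ^+ a.+1 * Q ^+ b.+1 by rewrite -exprD addSn addnS.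
  by ring.
Qed.

(** By induction the two Pascal expansions differ by [(1 - Q^(b+1)) gauss a (b+1) - (1 - Q^(a+1))
    gauss (a+1) b], which is 0 by [gauss_ratios]. *)
Lemma gauss_sym a b : gauss a b = gauss b a.
Proof.
have [s] := ubnP (a + b); elim: s => // s IHs in a b *; rewrite ltnS => le_ab_s.
case: a b => [|a] [|b] in le_ab_s *; rewrite ?gauss0n ?gaussn0 //.
have [r1 r2] := gauss_ratios a b.
rewrite !gaussSS (IHs b a.+1) ?(IHs b.+1 a); [|lia..].
rewrite -r2 in r1; apply/eqP; rewrite -subr_eq0; apply/eqP.
rewrite -(subrr ((1 - Q ^+ b.+1) * gauss a b.+1)) {2}r1; ring.
Qed.

Definition gauss_sum (N : nat) (f : nat -> R) : R :=
  \sum_(k < N.+1) f k * gauss k (N - k).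

Lemma eq_gauss_sum N (f g : nat -> R) :
  (forall k, (k <= N)%N -> f k = g k) -> gauss_sum N f = gauss_sum N g.
Proof. by move=> fg; apply: eq_bigr => k _; rewrite fg // -ltnS. Qed.

Lemma gauss_sum_rev N (f : nat -> R) :
  gauss_sum N f = gauss_sum N (fun k => f (N - k)%N).
Proof.
rewrite /gauss_sum (reindex_inj rev_ord_inj) /=; apply: eq_bigr => k _.
by rewrite subSS subKn 1?gauss_sym // -ltnS.
Qed.

Lemma gauss_sumS N (f : nat -> R) :
  gauss_sum N.+1 f =
  gauss_sum N (fun k => f k.+1) + gauss_sum N (fun k => f k * Q ^+ k).
Proof.
rewrite /gauss_sum big_ord_recl big_ord_recr /= subnn.
rewrite [X in _ = X + _]big_ord_recr [X in _ = _ + X]big_ord_recl /=.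
rewrite subnn !gaussn0 !gauss0n expr0 !mulr1.
set A := (X in _ = (X + _) + _); set B := (X in _ = _ + (_ + X)).
set T := (X in _ + (X + _) = _).
suff -> : T = A + B by ring.
rewrite /A /B /T -big_split /=; apply: eq_bigr => k _; rewrite /bump /=.
have -> : (N.+1 - k.+1 = (N - k.+1).+1)%N by have := ltn_ord k; lia.
have -> : (N - k = (N - k.+1).+1)%N by have := ltn_ord k; lia.
by rewrite gaussSS add1n mulrDr mulrA.
Qed.

End GaussianBinomials.

(** * Cauchy's Durfee-rectangle identity, truncated *)

Section DurfeeRectangles.

Local Open Scope ring_scope.

(* [Q] plays the role of a formal variable truncated at order [M]. *)
Variables (R : comNzRingType) (Q : R) (M : nat).
Hypothesis QM0 : Q ^+ M = 0.

(** This is [(Q^(a+1); Q)_oo]: the factors from [i = M] on equal 1. *)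
Definition qtail (a : nat) : R := \prod_(a <= i < M) (1 - Q ^+ i.+1).

(* [(Q;Q)_oo / ((Q;Q)_a (Q;Q)_b)] *)
Definition durfee_weight (a b : nat) : R := gauss R Q a b * qtail (a + b).

Definition durfee_sum (m : nat) : R :=
  \sum_(k < M) Q ^+ (k * (k + m)) * durfee_weight k (k + m).

Lemma truncated_expr i : (M <= i)%N -> Q ^+ i = 0.
Proof. by move=> leMi; rewrite -(subnKC leMi) exprD QM0 mul0r. Qed.

Lemma qtailS a : qtail a = (1 - Q ^+ a.+1) * qtail a.+1.
Proof.
have [ltaM|leMa] := ltnP a M; first by rewrite /qtail big_ltn.
by rewrite /qtail !big_geq ?truncated_expr ?subr0 ?mulr1 //; lia.
Qed.

Lemma durfee_weightSr a b :
  durfee_weight a b = (1 - Q ^+ b.+1) * durfee_weight a b.+1.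
Proof.
rewrite /durfee_weight addnS mulrA (gauss_ratios R Q a b).1 qtailS; ring.
Qed.

Lemma durfee_weightSl a b :
  durfee_weight a b = (1 - Q ^+ a.+1) * durfee_weight a.+1 b.
Proof.
rewrite /durfee_weight addSn mulrA (gauss_ratios R Q a b).2 qtailS; ring.
Qed.

(** Raising the second index of the weight costs [1 - Q^(k+m+1)], which leaves a factor [1 - Q^k];
    this lowers the first index, and shifting [k] gives [durfee_sum m.+2]. *)
Lemma durfee_sum_diff m :
  durfee_sum m - durfee_sum m.+1 =
  - Q ^+ m.+1 * (durfee_sum m.+1 - durfee_sum m.+2).
Proof.
have -> : durfee_sum m - durfee_sum m.+1 =
    \sum_(k < M) (Q ^+ (k * (k + m)) * (1 - Q ^+ k) * durfee_weight k (k + m.+1))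
    - Q ^+ m.+1 * durfee_sum m.+1.
  rewrite /durfee_sum mulr_sumr -!sumrB; apply: eq_bigr => k _.
  rewrite (durfee_weightSr k (k + m)) -addnS.
  have -> : Q ^+ (k * (k + m.+1)) = Q ^+ (k * (k + m)) * Q ^+ k.
    by rewrite -exprD; congr (_ ^+ _); lia.
  rewrite exprD; ring.
suff -> : \sum_(k < M)
    (Q ^+ (k * (k + m)) * (1 - Q ^+ k) * durfee_weight k (k + m.+1))
    = Q ^+ m.+1 * durfee_sum m.+2 by ring.
set t := fun k => Q ^+ (k * (k + m)) * (1 - Q ^+ k) * durfee_weight k (k + m.+1).
(* Both [t 0] and [t M] vanish, so the index can be shifted by one. *)
have tM0 : t M = 0 by rewrite /t truncated_expr ?mul0r //; nia.
transitivity (\sum_(k < M.+1) t k); first by rewrite big_ord_recr /= tM0 addr0.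
rewrite big_ord_recl {1}/t subrr mulr0 mul0r add0r.
rewrite /durfee_sum mulr_sumr; apply: eq_bigr => k _.
rewrite /t /= /bump /= -mulrA [(1 + k + _)%N]addSnnS -durfee_weightSl mulrA -exprD.
by rewrite !addnS; congr (Q ^+ _ * _); lia.
Qed.

(** Iterating [durfee_sum_diff] makes the difference divisible by every power of the nilpotent
    [Q]. *)
Lemma durfee_sum_const m : durfee_sum m = durfee_sum m.+1.
Proof.
have small t : exists c, durfee_sum m - durfee_sum m.+1 = Q ^+ t * c.
  elim: t m => [|t IHt] m; first by eexists; rewrite mul1r.
  have [c Dc] := IHt m.+1.
  exists (- Q ^+ m * c); rewrite durfee_sum_diff Dc !exprS; ring.
have [c Dc] := small M.
by apply/eqP; rewrite -subr_eq0 Dc QM0 mul0r.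
Qed.

(** By constancy [m] may be replaced by [m + M], where only the term [k = 0] survives truncation. *)
Lemma durfee_sumE m : (0 < M)%N -> durfee_sum m = 1.
Proof.
move=> M_gt0.
have -> : durfee_sum m = durfee_sum (m + M).
  by elim: M => [|i IHi]; rewrite ?addn0 // addnS -durfee_sum_const.
rewrite /durfee_sum (bigD1 (Ordinal M_gt0)) //= mul1r big1 => [|k k_neq0].
  by rewrite addr0 /durfee_weight gauss0n mul1r /qtail big_geq //; lia.
have k_gt0 : (0 < k)%N by
  rewrite lt0n; apply: contraNneq k_neq0 => k0; apply/eqP/val_inj.
by rewrite truncated_expr ?mul0r //; nia.
Qed.

End DurfeeRectangles.

(** * Quadratic exponents *)

(* [nonneg_quad c r = ((2 c + 1) r^2 + r) / 2]; the triangular number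
   [r (r + 1) / 2] takes the same value at [k] and at [- k - 1]. *)
Definition nonneg_quad (c : nat) (r : int) : nat :=
  c * `|r| ^ 2 + match r with Posz k | Negz k => 'C(k.+1, 2) end.

Section QuadraticExponents.

Local Open Scope ring_scope.

Lemma nonneg_quadE c r :
  2 * (nonneg_quad c r)%:Z = (2 * c%:Z + 1) * r ^+ 2 + r.
Proof.
have triE k : ('C(k.+1, 2) * 2 = k.+1 * k)%N.
  by elim: k => // k IHk; rewrite binS bin1 mulnDl IHk; lia.
rewrite /nonneg_quad -mulnn.
case: r => k; have := triE k; move: 'C(_, _) => C.
all: rewrite ?NegzE ?abszN ?absz_nat expr2; lia.
Qed.

(** Twice the difference of two values is [(r - s) ((2c+1) (r+s) + 1)], and [2c+1 >= 3] does not
    divide 1. *)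
Lemma nonneg_quad_inj c : (0 < c)%N -> injective (nonneg_quad c).
Proof.
move=> c_gt0 r s eq_rs; have := nonneg_quadE c r; rewrite eq_rs nonneg_quadE.
move=> eq2; have : (r - s) * ((2 * c%:Z + 1) * (r + s) + 1) = 0 by lia.
move/eqP; rewrite mulf_eq0 subr_eq0 => /orP[/eqP//|/eqP].
by move: (r + s) => t; case: (Num.Theory.lerP 0 t) => ?; nia.
Qed.

End QuadraticExponents.

(** * Rogers-Selberg identity in characteristic 2 *)

Section CharacteristicTwo.

Local Open Scope ring_scope.

Variables (R : comNzRingType) (q : R).
Hypothesis pchar2 : 2 \in [pchar R].

(** The involution [k -> 2n+1-k] has no fixed point and pairs equal terms, which cancel modulo 2. *)
Lemma gauss_sum_odd_sym (Q : R) n (f : nat -> R) :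
  (forall k, (k <= n.*2.+1)%N -> f (n.*2.+1 - k)%N = f k) ->
  gauss_sum R Q n.*2.+1 f = 0.
Proof.
move=> fsym; rewrite /gauss_sum.
rewrite -(big_mkord xpredT (fun k => f k * gauss R Q k (n.*2.+1 - k))).
rewrite (@big_cat_nat _ _ _ n.+1) //=; last by lia.
rewrite -{2}[n.+1]add0n big_addn (_ : n.*2.+2 - n.+1 = n.+1)%N; last by lia.
rewrite [X in _ + X]big_nat_rev /= -big_split big_nat big1 //= => k lekn.
rewrite (_ : (0 + n.+1 - k.+1 + n.+1 = n.*2.+1 - k)%N); last by lia.
rewrite fsym; last by lia.
rewrite subKn; last by lia.
by rewrite gauss_sym addrr_pchar2.
Qed.

(* The finite Bailey-type identity
   [\sum_r (-1)^r q^(r (3 r + 1) / 2) (2 n choose n - r)_(q^2) = (q; q^2)_n],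
   whose signs are invisible modulo 2. *)
Lemma finite_pentagonal n :
  gauss_sum R (q ^+ 2) n.*2 (fun k => q ^+ nonneg_quad 1 (n%:Z - k%:Z)) =
  \prod_(i < n) (1 + q ^+ i.*2.+1).
Proof.
elim: n => [|n IHn].
  by rewrite big_ord0 /gauss_sum big_ord1 gauss0n mulr1.
(* Two Pascal steps lead from [2n] to [2n+2]. The first leaves a symmetric sum that cancels; after
   reversal, the second splits the rest into the sum for [n] and [q^(2n+1)] times it. *)
rewrite big_ord_recr /= -IHn doubleS gauss_sumS [X in _ + X]gauss_sum_odd_sym.
  rewrite addr0 gauss_sum_rev gauss_sumS mulrDr mulr1; congr (_ + _).
    rewrite gauss_sum_rev; apply: eq_gauss_sum => k lek.
    by congr (q ^+ nonneg_quad 1 _); lia.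
  rewrite /gauss_sum mulr_suml; apply: eq_bigr => k _.
  rewrite [RHS]mulrAC -exprM -!exprD; congr (q ^+ _ * _).
  have := ltn_ord k; have := nonneg_quadE 1 (n%:Z - k%:Z).
  have := nonneg_quadE 1 (n.+1%:Z - (n.*2.+1 - k).+1%:Z).
  rewrite (_ : (n.+1%:Z - (n.*2.+1 - k).+1%:Z = k%:Z - n%:Z - 1));
    last by have := ltn_ord k; lia.
  by lia.
move=> k lek; rewrite -!exprM -!exprD; congr (q ^+ _).
have := nonneg_quadE 1 (n.+1%:Z - k%:Z).
have := nonneg_quadE 1 (n.+1%:Z - (n.*2.+1 - k)%N%:Z).
rewrite (_ : (n.+1%:Z - (n.*2.+1 - k)%N%:Z = k%:Z - n%:Z)); last by lia.
by lia.
Qed.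

Lemma fold_sum_center j (F : nat -> R) :
  \sum_(k < j.*2.+1) F k =
  \sum_(r < j.+1) (F (j - r)%N + (if (0 < r)%N then F (j + r)%N else 0)).
Proof.
rewrite big_split /= -(big_mkord xpredT) (@big_cat_nat _ _ _ j.+1) //=; last by lia.
congr (_ + _).
  by rewrite big_nat_rev big_mkord; apply: eq_bigr => k _; congr F; lia.
rewrite big_ord_recl /= add0r -{1}[j.+1]add0n big_addn.
rewrite (_ : j.*2.+1 - j.+1 = j)%N; last by lia.
by rewrite big_mkord; apply: eq_bigr => k _; congr F; rewrite /bump /=; lia.
Qed.

Variable M : nat.
Hypothesis q2M0 : (q ^+ 2) ^+ M = 0.
Hypothesis M_gt0 : (0 < M)%N.

Notation Q := (q ^+ 2).
Notation weight := (durfee_weight R Q M).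

(** Summing over [j = k + r] first, [j^2 = r^2 + k (k + 2r)] isolates [durfee_sum] at [2r], which is
    1. *)
Lemma sum_durfee_weight (c : nat -> R) :
  \sum_(j < M) Q ^+ (j ^ 2) * \sum_(r < j.+1) c r * weight (j - r) (j + r) =
  \sum_(r < M) c r * Q ^+ (r ^ 2).
Proof.
transitivity (\sum_(j < M) \sum_(r < M | (r <= j)%N)
    c r * (Q ^+ (j ^ 2) * weight (j - r) (j + r))).
  apply: eq_bigr => j _; rewrite mulr_sumr.
  rewrite (big_ord_widen _ (fun r =>
    Q ^+ (j ^ 2) * (c r * weight (j - r) (j + r))) (ltn_ord j)).
  by apply: eq_big => // r _; rewrite mulrCA.
rewrite (exchange_big_dep xpredT) //=; apply: eq_bigr => r _.
rewrite -mulr_sumr -[in RHS](mulr1 (Q ^+ _)) -(durfee_sumE _ _ _ q2M0 r.*2 M_gt0).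
congr (_ * _); rewrite /durfee_sum mulr_sumr.
set F := fun j => Q ^+ (j ^ 2) * weight (j - r) (j + r).
have ltrM := ltn_ord r.
(* The added terms [j >= M] vanish; the shifted range is then exactly [k < M]. *)
transitivity (\sum_(r <= j < M + r) F j).
  rewrite -(big_mkord (fun j => r <= j)%N F)
    (@big_cat_nat _ _ _ r _ M) //=; last by lia.
  rewrite big_nat_cond big1 ?add0r => [|j]; last by lia.
  rewrite (@big_cat_nat _ _ _ M r (M + r)) //=; [|lia..].
  rewrite [X in _ = _ + X]big_nat_cond [X in _ = _ + X]big1 ?addr0 => [|j jM].
    rewrite big_nat_cond [RHS]big_nat_cond; apply: eq_bigl => j; lia.
  by rewrite /F (truncated_expr _ _ _ q2M0) ?mul0r // -mulnn; nia.
rewrite -{1}[r : nat]add0n big_addn addnK big_mkord; apply: eq_bigr => k _.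
rewrite /F mulrA -exprD addnK -addnA addnn; congr (_ ^+ _ * _); rewrite -!mulnn; nia.
Qed.

Lemma rogers_selberg_mod2 :
  \sum_(j < M) Q ^+ (j ^ 2) * (\prod_(i < j) (1 + q ^+ i.*2.+1) * qtail R Q M j.*2)
  = \sum_(r < M) (q ^+ nonneg_quad 3 (Posz r) + q ^+ nonneg_quad 3 (Negz r)).
Proof.
(* [c r] merges the terms of index [r] and [-r], counting the centre once. *)
pose c r := q ^+ nonneg_quad 1 (Posz r) +
  (if r is s.+1 then q ^+ nonneg_quad 1 (Negz s) else 0).
have quad13 r : nonneg_quad 3 r = (nonneg_quad 1 r + 2 * `|r| ^ 2)%N.
  by rewrite /nonneg_quad; lia.
transitivity (\sum_(r < M) c r * Q ^+ (r ^ 2)).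
  rewrite -sum_durfee_weight; apply: eq_bigr => j _; congr (_ * _).
  rewrite -finite_pentagonal /gauss_sum mulr_suml.
  rewrite (fold_sum_center j (fun k => q ^+ nonneg_quad 1 (j%:Z - k%:Z) *
     gauss R Q k (j.*2 - k) * qtail R Q M j.*2)).
  apply: eq_bigr => r _; have lerj : (r <= j)%N by rewrite -ltnS.
  have -> : j%:Z - (j - r)%N%:Z = r by lia.
  have -> : (j.*2 - (j - r) = j + r)%N by lia.
  have Dw : weight (j - r) (j + r) = gauss R Q (j - r) (j + r) * qtail R Q M j.*2.
    by rewrite /durfee_weight; congr (_ * qtail R Q M _); lia.
  rewrite mulrDl {1}Dw mulrA; congr (_ + _).
  case: (r : nat) lerj Dw => [|s] lesj Dw /=; first by rewrite mul0r.
  rewrite -mulrA Dw (gauss_sym _ _ (j - _)%N).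
  by congr (q ^+ nonneg_quad 1 _ * (gauss _ _ _ _ * _)); lia.
transitivity (\sum_(r < M) (q ^+ nonneg_quad 3 r) +
  \sum_(r < M) q ^+ nonneg_quad 3 (Negz r)); last by rewrite big_split.
rewrite /c; under eq_bigr do rewrite mulrDl.
rewrite big_split /=; congr (_ + _).
  by apply: eq_bigr => r _; rewrite quad13 exprD exprM absz_nat.
pose t k := (if k is s.+1 then q ^+ nonneg_quad 1 (Negz s) else 0) * Q ^+ (k ^ 2).
have tM0 : t M = 0 by rewrite /t (truncated_expr _ _ _ q2M0) ?mulr0 //; nia.
transitivity (\sum_(k < M.+1) t k); first by rewrite big_ord_recr /= tM0 addr0.
rewrite big_ord_recl {1}/t mul0r add0r; apply: eq_bigr => k _.
by rewrite /t quad13 exprD exprM NegzE abszN absz_nat.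
Qed.

End CharacteristicTwo.

(** * Splitting the partition condition by [j] *)

(* [j = 0] encodes case (a) of the definition of [c5]. *)
Definition c5_mult_ok (j k a : nat) : bool :=
  if odd k then (if k <= 2 * j - 1 then (a == 2) || (a == 3) else a == 0)
  else (a <= 1) && ((0 < a) ==> (4 * j + 2 <= k)).

Definition c5_cond (n j : nat) (m : {ffun 'I_n -> 'I_n.+1}) : bool :=
  [forall k : 'I_(2 * n).+1, c5_mult_ok j k (mult m k)].

(** Each multiplicity is constrained separately, so that the sum over [m] factors into a product
    over parts. *)
Definition c5_family (n j : nat) : pred {ffun 'I_n -> 'I_n.+1} :=
  family (fun i : 'I_n => [pred a : 'I_n.+1 | c5_mult_ok j i.+1 a]).

Lemma mult_ordS n (m : {ffun 'I_n -> 'I_n.+1}) (i : 'I_n) : mult m i.+1 = m i.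
Proof.
by rewrite /mult (big_pred1 i).
Qed.

Lemma mult_out n (m : {ffun 'I_n -> 'I_n.+1}) k :
  (k == 0) || (n < k) -> mult m k = 0.
Proof.
move=> k_out; rewrite /mult big_pred0 // => i.
by apply/negbTE; move: k_out; have := ltn_ord i; lia.
Qed.

Lemma c5_cond_family n j m : 2 * j <= n.+1 -> c5_cond n j m = c5_family n j m.
Proof.
move=> le_j_n; apply/forallP/familyP => [ok_m i|ok_m k].
  have lt_i : i.+1 < (2 * n).+1 by have := ltn_ord i; lia.
  by have := ok_m (Ordinal lt_i); rewrite inE /= mult_ordS.
have [k_out|] := boolP ((k == 0 :> nat) || (n < k)).
  rewrite mult_out // /c5_mult_ok; case: ifP => // odd_k.
  by rewrite ifF //; lia.
case: (k : nat) => // i lt_i_n; have {}lt_i_n : i < n by lia.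
by have := ok_m (Ordinal lt_i_n); rewrite inE -mult_ordS.
Qed.

Lemma c5_cond_large n j m : j <= n -> n.+1 < 2 * j -> c5_cond n j m = false.
Proof.
move=> le_j_n lt_n_j; apply/negbTE/forallPn.
have lt_k : 2 * j - 1 < (2 * n).+1 by lia.
exists (Ordinal lt_k); rewrite /c5_mult_ok /= mult_out; last by lia.
by rewrite (_ : odd _) ?leqnn //; lia.
Qed.

(** For [j1 < j2], the part [2 * j2 - 1] is required by [j2] and forbidden by [j1]. *)
Lemma c5_cond_uniq n j1 j2 m :
  c5_cond n j1 m -> c5_cond n j2 m -> j1 <= n -> j2 <= n -> j1 = j2.
Proof.
wlog lt12 : j1 j2 / j1 < j2 => [wlog_lt c1 c2 le1 le2|+ + le1 le2].
  case: (ltngtP j1 j2) => // lt12; first exact: wlog_lt le1 le2.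
  by apply/esym; exact: wlog_lt le2 le1.
have lt_k : 2 * j2 - 1 < (2 * n).+1 by lia.
move=> /forallP/(_ (Ordinal lt_k)) + /forallP/(_ (Ordinal lt_k)).
rewrite /c5_mult_ok /= (_ : odd _); last by lia.
by rewrite leqnn ifF; [move=> /eqP-> | lia].
Qed.

(** At [j = 0] the truncated bound [2 * j - 1] is 0, below every odd [k], and every positive even
    part is at least 2; this is case (a). *)
Lemma c5_cond_exists n (m : {ffun 'I_n -> 'I_n.+1}) :
  c5_condA m || c5_condB m = [exists j : 'I_n.+1, c5_cond n j m].
Proof.
have condA : c5_condA m = c5_cond n 0 m.
  apply/forallP/forallP => ok_m k.
    have [k_out|k_in] := boolP ((k == 0 :> nat) || (n < k)).
      by rewrite mult_out // /c5_mult_ok; case: ifP => // odd_k; rewrite ifF //; lia.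
    have lt_k : k < n.+1 by lia.
    have := ok_m (Ordinal lt_k); rewrite /c5_mult_ok /=.
    case: ifP => odd_k /andP[le1 e0]; first by rewrite ifF //; lia.
    by rewrite le1; apply/implyP => _; lia.
  have lt_k : k < (2 * n).+1 by have := ltn_ord k; lia.
  have := ok_m (Ordinal lt_k); rewrite /c5_mult_ok /=.
  case: ifP => odd_k; last by case/andP=> ->.
  by rewrite ifF; [move=> /eqP-> | lia].
apply/orP/existsP => [[cA|/existsP[j /andP[_ cB]]]|[j cj]].
- by exists ord0; rewrite -condA.
- by exists j.
have [j0|j_gt0] := posnP j; first by left; rewrite condA -j0.
by right; apply/existsP; exists j; rewrite j_gt0.
Qed.

(** * The partition series as a sum of products *)

Section PartitionSeries.

Local Open Scope ring_scope.

Variables (R : comNzRingType) (q : R) (n : nat).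
Hypothesis qn0 : q ^+ n.+1 = 0.

Definition c5_factor (j k : nat) : R :=
  if odd k then (if (k <= 2 * j - 1)%N then q ^+ (2 * k) * (1 + q ^+ k) else 1)
  else if (4 * j + 2 <= k)%N then 1 + q ^+ k else 1.

Lemma c5_factorE j k :
  (0 < k)%N ->
  \sum_(a < n.+1 | c5_mult_ok j k a) q ^+ (k * a) = c5_factor j k.
Proof.
move=> k_gt0.
(* Both ranges sit inside [a < n + 5]: terms with [a > n] are killed by [qn0], and no [a >= 4] is
   admissible. *)
have -> : \sum_(a < n.+1 | c5_mult_ok j k a) q ^+ (k * a) =
          \sum_(a < 4 | c5_mult_ok j k a) q ^+ (k * a).
  transitivity (\sum_(0 <= a < n.+1 + 4 | c5_mult_ok j k a) q ^+ (k * a)).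
    rewrite (@big_cat_nat _ _ _ n.+1) ?leq_addr //= big_mkord.
    rewrite [X in _ + X]big_nat_cond [X in _ + X]big1 ?addr0 // => a le_a.
    by apply: truncated_expr qn0 _ _; nia.
  rewrite (@big_cat_nat _ _ _ 4) ?leq_addl //= big_mkord.
  rewrite [X in _ + X]big_nat_cond [X in _ + X]big1 ?addr0 // => a.
  by rewrite /c5_mult_ok; do 2?case: ifP => //; lia.
rewrite big_mkcond !big_ord_recr big_ord0 /= /c5_mult_ok /c5_factor.
case: (odd k); [case: (k <= 2 * j - 1)%N | case: (4 * j + 2 <= k)%N] => /=;
  rewrite ?muln0 ?muln1 ?add0r ?addr0 ?expr0 //.
by rewrite mulrDr mulr1 -exprD mulnC; congr (_ + q ^+ _); lia.
Qed.

Lemma prod_even_odd (F : nat -> R) N :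
  \prod_(0 <= i < N.*2) F i =
  \prod_(0 <= i < N) F i.*2 * \prod_(0 <= i < N) F i.*2.+1.
Proof.
elim: N => [|N IHN]; first by rewrite !big_geq // mulr1.
by rewrite doubleS !big_nat_recr //= IHN; ring.
Qed.

(** The compulsory pairs of odd parts weigh [2 (1 + 3 + ... + (2j-1)) = 2 j^2]; an even part [2i+2]
    is allowed exactly when [i >= 2j]. *)
Lemma prod_c5_factor j :
  (2 * j <= n.+1)%N ->
  \prod_(i < n) c5_factor j i.+1 =
  (q ^+ 2) ^+ (j ^ 2) *
    (\prod_(i < j) (1 + q ^+ i.*2.+1) *
     \prod_(j.*2 <= i < n.+1) (1 + (q ^+ 2) ^+ i.+1)).
Proof.
move=> le_j_n.
transitivity (\prod_(0 <= i < n.+1.*2) c5_factor j i.+1).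
  rewrite (@big_cat_nat _ _ _ n) //=; last by lia.
  rewrite big_mkord [X in _ * X]big_nat_cond [X in _ * X]big1 ?mulr1 // => i le_i.
  rewrite /c5_factor (truncated_expr _ _ _ qn0 i.+1); last by lia.
  by rewrite addr0; case: ifP => odd_i; rewrite ?if_same // ifF //; lia.
rewrite prod_even_odd mulrA; congr (_ * _).
  rewrite (@big_cat_nat _ _ _ j) //=; last by lia.
  rewrite [X in _ * X]big_nat_cond [X in _ * X]big1 => [|i le_i]; last first.
    by rewrite /c5_factor ifT ?ifF //; lia.
  rewrite mulr1.
  transitivity (\prod_(0 <= i < j) (q ^+ (2 * i.*2.+1) * (1 + q ^+ i.*2.+1))).
    by apply: eq_big_nat => i le_i; rewrite /c5_factor !ifT //; lia.
  rewrite big_split big_mkord /= big_mkord; congr (_ * _).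
  elim: j {le_j_n} => [|j IHj]; first by rewrite big_ord0.
  rewrite big_ord_recr /= IHj -!exprM -exprD -!mulnn.
  by congr (q ^+ _); lia.
have [le_jn|lt_nj] := leqP j.*2 n.+1; last by lia.
rewrite (@big_cat_nat _ _ _ j.*2) //=.
rewrite big_nat_cond big1 ?mul1r => [|i le_i]; last first.
  by rewrite /c5_factor !ifF //; lia.
apply: eq_big_nat => i le_i; rewrite /c5_factor ifF ?ifT -?exprM; [|lia..].
by congr (1 + q ^+ _); lia.
Qed.

Hypothesis pchar2 : 2 \in [pchar R].

Lemma c5_series :
  \sum_(m : {ffun 'I_n -> 'I_n.+1} | c5_condA m || c5_condB m)
    q ^+ (\sum_(i < n) i.+1 * m i)%N =
  \sum_(r < n.+1) (q ^+ nonneg_quad 3 (Posz r) + q ^+ nonneg_quad 3 (Negz r)).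
Proof.
have q2n0 : (q ^+ 2) ^+ n.+1 = 0.
  by rewrite -exprM; apply: truncated_expr qn0 _ _; lia.
rewrite -(rogers_selberg_mod2 _ _ pchar2 _ q2n0) //.
(* By uniqueness of [j], the inner sum has one term or none. *)
transitivity (\sum_(m : {ffun 'I_n -> 'I_n.+1}) \sum_(j < n.+1 | c5_cond n j m)
    q ^+ (\sum_(i < n) i.+1 * m i)%N).
  rewrite big_mkcond; apply: eq_bigr => m _; rewrite c5_cond_exists.
  case: existsP => [[j cj]|no_j]; last first.
    by rewrite big1 // => j cj; case: no_j; exists j.
  rewrite (big_pred1 j) // => k /=; apply/idP/eqP => [ck|->//].
  by apply/val_inj/(c5_cond_uniq n k j m ck cj); rewrite -ltnS.
rewrite (exchange_big_dep xpredT) //=; apply: eq_bigr => j _.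
have [le_j_n|lt_n_j] := leqP (2 * j) n.+1; last first.
  (* For such [j] no partition qualifies, and [j^2 > n] kills the other side. *)
  rewrite big_pred0 => [|m]; last by rewrite c5_cond_large // -ltnS.
  by rewrite (truncated_expr _ _ _ q2n0) ?mul0r // -mulnn; nia.
rewrite (eq_bigl (fun m => m \in c5_family n j)) => [|m]; last exact: c5_cond_family.
rewrite /qtail; under [X in _ * (_ * X)]eq_bigr do rewrite oppr_pchar2 //.
rewrite -prod_c5_factor //.
under [RHS]eq_bigr do rewrite -c5_factorE //.
rewrite bigA_distr_big_dep; apply: eq_bigr => m _.
by rewrite -expr_sum.
Qed.

End PartitionSeries.

(** * Coefficient extraction and parity *)

Lemma coef_sum_Xn (R : nzRingType) (I : finType) (P : pred I) (e : I -> nat) n :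
  ((\sum_(i | P i) 'X^(e i) : {poly R})`_n = #|[set i | P i && (e i == n)]|%:R)%R.
Proof.
rewrite coef_sum -sum1dep_card natr_sum big_mkcondr /=.
by apply: eq_bigr => i _; rewrite coefXn eq_sym; case: eqP.
Qed.

(** Reduction modulo [X^(n+1)] preserves the coefficient of [X^n], which over [F_2] is the parity of
    each count. *)
Lemma c5_parity n :
  odd (c5 n) =
  odd #|[set x : bool * 'I_n.+1 |
    nonneg_quad 3 (if x.1 then Posz x.2 else Negz x.2) == n]|.
Proof.
pose p : {poly 'F_2} := ('X^(n.+1))%R.
have pchar2 : 2 \in [pchar {poly %/ p}]%R by rewrite pchar_qpoly pchar_Fp.
have qn0 : (in_qpoly p 'X ^+ n.+1 = 0)%R.
  rewrite -rmorphXn /=; apply/val_inj => /=.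
  rewrite mk_monic_Xn -Pdiv.RingMonic.take_poly_rmodp.
  apply/polyP => i; rewrite coef_take_poly coefXn coef0.
  by case: ifP => // lt_i; rewrite ltn_eqF.
have := c5_series {poly %/ p} (in_qpoly p 'X)%R n qn0 pchar2.
have parityE a b : (a%:R = b%:R :> 'F_2)%R -> odd a = odd b.
  by move/(congr1 val); rewrite /= !val_Fp_nat // !modn2 => /esym; do 2!case: odd.
set A := (\sum_(m : {ffun 'I_n -> 'I_n.+1} | c5_condA m || c5_condB m)
   'X^(\sum_(i < n) i.+1 * m i)%N : {poly 'F_2})%R.
set B := (\sum_(x : bool * 'I_n.+1)
   'X^(nonneg_quad 3 (if x.1 then Posz x.2 else Negz x.2)) : {poly 'F_2})%R.
move=> eqAB; suff : (A`_n = B`_n)%R.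
  rewrite /A /B !coef_sum_Xn => /parityE; rewrite /c5 => eqc.
  by rewrite -[RHS]eqc; congr (odd _); apply: eq_card => m; rewrite !inE andbC.
have : in_qpoly p A = in_qpoly p B.
  rewrite !rmorph_sum /=; under eq_bigr do rewrite rmorphXn.
  under [RHS]eq_bigr do rewrite rmorphXn.
  rewrite eqAB -(pair_big xpredT xpredT (fun (b : bool) (r : 'I_n.+1) =>
    in_qpoly p 'X ^+ nonneg_quad 3 (if b then Posz r else Negz r)))%R /=.
  by rewrite big_bool -big_split.
move/(congr1 val); rewrite /= mk_monic_Xn -!Pdiv.RingMonic.take_poly_rmodp.
by move/(congr1 (fun r : {poly 'F_2} => r`_n)%R); rewrite !coef_take_poly ltnSn.
Qed.

Theorem theorem6 (n : nat) :
  odd (c5 n) <-> exists j : int, (2 * (n%:Z) = 7 * j ^+ 2 + j)%R.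
Proof.
rewrite c5_parity; set S := [set x | _].
pose g (x : bool * 'I_n.+1) := if x.1 then Posz x.2 else Negz x.2.
have g_inj : injective g.
  by move=> [[] x] [[] y] //= [] /val_inj->.
(* Injectivity turns the parity of [#|S|] into nonemptiness. *)
have S_le1 : #|S| <= 1.
  apply/card_le1_eqP => x y; rewrite !inE => /eqP xn /eqP yn.
  by apply/g_inj/(nonneg_quad_inj 3) => //; rewrite xn yn.
have -> : odd #|S| = (S != set0) by rewrite -card_gt0; case: #|S| S_le1 => [|[]].
split=> [/set0Pn[x]|[j Dj]].
  rewrite inE => /eqP quad_x; exists (g x).
  by rewrite -quad_x nonneg_quadE.
have quad_j : nonneg_quad 3 j = n.
  by have := nonneg_quadE 3 j; lia.
(* Any solution [j] is [Posz k] or [Negz k] with [k <= n], so the truncated index range misses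
   none. *)
have [x Dx] : exists x, g x = j.
  case: j Dj {quad_j} => k Dk.
    have lt_k : k < n.+1 by nia.
    by exists (true, Ordinal lt_k).
  have lt_k : k < n.+1 by rewrite NegzE in Dk; nia.
  by exists (false, Ordinal lt_k).
by apply/set0Pn; exists x; rewrite inE -[if _ then _ else _]/(g x) Dx quad_j.
Qed.
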